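(* Let $(L_n)_{n\ge0}$ be the Lambert family associated to $A(X)=-X$, let $F(T,X)=\sum_{n\ge0}L_n(X)T^n$ be its generating function, and write $F(T,X)^2=\sum_{n\ge0}L_{n,2}(X)T^n$. (1) For $n\ge1$ we have $$L_{n,2}(X)=-2(n+1)\int_0^X L_n(t)\,dt=-\frac{2(n+1)}{n}\bigl(L_{n+1}(X)+L_n(X)\bigr)\;.$$ Equivalently, $\bigl(L_{n,2}(X)/(n+1)\bigr)_{n\ge0}$ is the Lambert family associated to $A(X)=X^2$. (2) The function $F$ satisfies the differential equation in $T$ $$TFF'+(1+T)F'+F=0\;,$$ where $F'=\partial F/\partial T$. (3) The function $F$ satisfies the implicit equation $$\log(1+TF)+F=-X\;.$$
   Context: For a polynomial $A(X)$ with $A(0)=0$, the Lambert family associated to $A$ is the sequence of polynomials $(P_n(X))_{n\ge0}$ defined by $P_0(X)=A(X)$ and, for $n\ge0$, $P_{n+1}(X)=-P_n(X)+n\int_0^X P_n(t)\,dt$. Generating functions are formal power series in $T$ with coefficients in $\mathbb{Q}[X]$, and $\log(1+TF)=\sum_{m\ge1}(-1)^{m-1}(TF)^m/m$ is understood formally. *)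

(* Defs.v *)
From mathcomp Require Import all_boot all_order all_algebra.

Set Implicit Arguments.
Unset Strict Implicit.
Unset Printing Implicit Defensive.

Import Order.TTheory GRing.Theory Num.Theory.

Local Open Scope ring_scope.

(* The polynomial \int_0^X p(t) dt. *)
Definition primitive (p : {poly rat}) : {poly rat} :=
  'X * \poly_(i < size p) (p`_i / i.+1%:R).

Lemma coef_primitive p i :
  (primitive p)`_i = if i is j.+1 then p`_j / j.+1%:R else 0.
Proof.
rewrite /primitive coefXM; case: i => [|i] //=; rewrite coef_poly.
by case: ltnP => // le_p_i; rewrite nth_default // mul0r.
Qed.

Lemma primitive_at0 p : (primitive p).[0] = 0.
Proof. by rewrite horner_coef0 coef_primitive. Qed.

Lemma deriv_primitive p : (primitive p)^`() = p.
Proof.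
apply/polyP => i; rewrite coef_deriv coef_primitive -[LHS]mulr_natr divfK //.
by rewrite pnatr_eq0.
Qed.

Definition lambert_family (A : {poly rat}) (P : nat -> {poly rat}) : Prop :=
  [/\ A.[0] = 0,
      P 0%N = A
    & forall n : nat, P n.+1 = - P n + n%:R *: primitive (P n)].

Lemma lambert_family_ex A : A.[0] = 0 -> exists P, lambert_family A P.
Proof.
move=> A0; pose step n (p : {poly rat}) := - p + n%:R *: primitive p.
by exists (fun n => nat_rect (fun=> {poly rat}) A step n); split.
Qed.

(* Formal power series in T over Q[X], given by their coefficient sequences;
   equality of series is pointwise equality of coefficients (=1). *)
Definition fps := nat -> {poly rat}.

Declare Scope fps_scope.
Delimit Scope fps_scope with fps.
Bind Scope fps_scope with fps.

Definition fps_const (p : {poly rat}) : fps := fun n => if n == 0%N then p else 0.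
Definition fps_T : fps := fun n => if n == 1%N then 1 else 0.
Definition fps_add (F G : fps) : fps := fun n => F n + G n.
Definition fps_mul (F G : fps) : fps := fun n => \sum_(i < n.+1) F i * G (n - i)%N.
Definition fps_exp (F : fps) (m : nat) : fps := iter m (fps_mul F) (fps_const 1).
Definition fps_deriv (F : fps) : fps := fun n => F n.+1 *+ n.+1.

Notation "0" := (fps_const 0) : fps_scope.
Notation "1" := (fps_const 1) : fps_scope.
Notation "F + G" := (fps_add F G) : fps_scope.
Notation "F * G" := (fps_mul F G) : fps_scope.
Notation "F ^+ m" := (fps_exp F m) : fps_scope.

Lemma fps_exp_small (G : fps) (m n : nat) :
  G 0%N = 0 -> (n < m)%N -> (G ^+ m)%fps n = 0.
Proof.
move=> G0; elim: m n => [|m IHm] n //= lt_n_m.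
rewrite /fps_mul big1 // => -[[|i] /= lt_i_n] _; first by rewrite G0 mul0r.
rewrite IHm ?mulr0 //; apply: leq_trans (ltnSE lt_n_m).
by rewrite ltn_subrL /=; apply: leq_trans (ltnSE lt_i_n).
Qed.

(* log(1 + G) = \sum_(m >= 1) (-1)^(m-1) G^m / m, meaningful when G 0 = 0:
   then, by fps_exp_small, the terms with m > n have zero n-th coefficient. *)
Definition fps_log1p (G : fps) : fps := fun n =>
  \sum_(1 <= m < n.+1) ((-1) ^+ m.-1 / m%:R) *: (G ^+ m)%fps n.

(* Main.v *)
Require Import Defs.
From mathcomp Require Import all_boot all_order all_algebra.
From HB Require Import structures.
From mathcomp Require Import boolp ring.
Import GRing.Theory Num.Theory.
Local Open Scope ring_scope.

(** Write d_X and d_T for the partial derivatives of power series in T over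
Q[X].  Differentiating the recursion of a Lambert family P in X removes the
integral: P_{n+1}' + P_n' = n P_n.  For the generating function of the family
of A this says that the derivation D = (1 + T) d_X - T^2 d_T sends it to the
constant A' ([lambert_deriv_family]).  Conversely, a series killed by D whose
coefficients all vanish at X = 0 is zero ([lambert_deriv_inj]).

The implicit equation then follows by applying D to
H = log (1 + T F) + F + X, where F is the generating function of the family of
- X and so D F = - 1.  Since D T = - T^2, we get
D (T F) = - T^2 F - T = - T (1 + T F), so the logarithm contributes - T, while
D F = - 1 and D X = 1 + T.  These add up to 0, and H vanishes at X = 0, hence
H = 0 ([lambert_implicit]).

Applying d_T to H = 0 and multiplying by 1 + T F gives the differential
equation ([lambert_ode]).  Its first term is half of T d_T (F^2), so comparing
coefficients of T^n gives n L_{n,2} = - 2 (n + 1) (L_{n+1} + L_n)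
([lambert_sqr_coef]), and the recursion turns L_{n+1} + L_n into n times the
primitive of L_n.  Thus L_{n,2} / (n + 1) is - 2 times the primitive of L_n for
every n ([lambert_sqr]); taking primitives commutes with the recursion, so this
is again a Lambert family.

Both uses of the logarithm rest on one identity, valid for any derivation d
that is local in the T-adic sense: (1 + G) d (log (1 + G)) = d G for G = T F
([derivation_log1p]). *)

Set Implicit Arguments.
Unset Strict Implicit.
Unset Printing Implicit Defensive.
Bind Scope ring_scope with fps.

(** * The ring of power series *)

Lemma fpsP (F G : fps) : F =1 G -> F = G.
Proof. by move=> eqFG; apply: funext. Qed.

(** [agree N p F] says that p and F are equal modulo T^N.  Products respect
this relation, which transfers the commutativity and associativity of the
product, and the Leibniz rule for d_T, from polynomials to series. *)
Definition agree (N : nat) (p : {poly {poly rat}}) (F : fps) : Prop :=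
  forall i, (i < N)%N -> p`_i = F i.

Definition fps_trunc (N : nat) (F : fps) : {poly {poly rat}} :=
  \poly_(i < N) F i.

Lemma agree_trunc N F : agree N (fps_trunc N F) F.
Proof. by move=> i ltiN; rewrite coef_poly ltiN. Qed.

Lemma agree_mul N p q F G :
  agree N p F -> agree N q G -> agree N (p * q) (fps_mul F G).
Proof.
move=> pF qG i ltiN; rewrite coefM; apply: eq_bigr => j _.
by rewrite pF ?qG //; apply: leq_ltn_trans ltiN; rewrite ?leq_subr // -ltnS.
Qed.

Lemma fps_mulC : commutative fps_mul.
Proof.
move=> F G; apply: fpsP => n.
have [tF tG] := (@agree_trunc n.+1 F, @agree_trunc n.+1 G).
by rewrite -(agree_mul tF tG) // mulrC (agree_mul tG tF).
Qed.

Lemma fps_mulA : associative fps_mul.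
Proof.
move=> F G K; apply: fpsP => n.
have [tF tG] := (@agree_trunc n.+1 F, @agree_trunc n.+1 G).
have tK := @agree_trunc n.+1 K.
rewrite -(agree_mul tF (agree_mul tG tK)) // mulrA.
by rewrite (agree_mul (agree_mul tF tG) tK).
Qed.

Lemma fps_mul_const p F n : fps_mul (fps_const p) F n = p * F n.
Proof.
by rewrite /fps_mul big_ord_recl subn0 big1 ?addr0 // => i _; rewrite mul0r.
Qed.

Lemma fps_mul1 : left_id (fps_const 1) fps_mul.
Proof. by move=> F; apply: fpsP => n; rewrite fps_mul_const mul1r. Qed.

Lemma fps_mulDl : left_distributive fps_mul fps_add.
Proof.
move=> F G K; apply: fpsP => n; rewrite /fps_add /fps_mul -big_split /=.
by apply: eq_bigr => i _; rewrite mulrDl.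
Qed.

Definition fps_opp (F : fps) : fps := fun n => - F n.

Lemma fps_addA : associative fps_add.
Proof. by move=> F G K; apply: fpsP => n; apply: addrA. Qed.

Lemma fps_addC : commutative fps_add.
Proof. by move=> F G; apply: fpsP => n; apply: addrC. Qed.

Lemma fps_add0 : left_id (fps_const 0) fps_add.
Proof. by move=> F; apply: fpsP => n; rewrite /fps_add /fps_const if_same add0r. Qed.

Lemma fps_addN : left_inverse (fps_const 0) fps_opp fps_add.
Proof. by move=> F; apply: fpsP => n; rewrite /fps_add /fps_const if_same addNr. Qed.

Lemma fps_oner_neq0 : fps_const 1 <> fps_const 0.
Proof. by move=> /(congr1 (fun F : fps => F 0%N)) /eqP; rewrite oner_eq0. Qed.

HB.instance Definition _ := gen_eqMixin fps.
HB.instance Definition _ := gen_choiceMixin fps.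
HB.instance Definition _ :=
  GRing.isZmodule.Build fps fps_addA fps_addC fps_add0 fps_addN.
HB.instance Definition _ := GRing.Zmodule_isComNzRing.Build fps
  fps_mulA fps_mulC fps_mul1 fps_mulDl (introN eqP fps_oner_neq0).

Implicit Types (F G K : fps) (n : nat).

Lemma fps_expE F m : fps_exp F m = F ^+ m.
Proof. by elim: m => [|m IHm] //; rewrite exprS -IHm. Qed.

Lemma coef_fps0 n : (0 : fps) n = 0.
Proof. exact: if_same. Qed.

Lemma coef_fpsD F G n : (F + G) n = F n + G n.
Proof. by []. Qed.

Lemma coef_fpsN F n : (- F) n = - F n.
Proof. by []. Qed.

Lemma coef_fpsM F G n : (F * G) n = \sum_(i < n.+1) F i * G (n - i)%N.
Proof. by []. Qed.

Lemma coef_constM p F n : (fps_const p * F) n = p * F n.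
Proof. exact: fps_mul_const. Qed.

Lemma coef_TM F n : (fps_T * F) n = if n is m.+1 then F m else 0.
Proof.
case: n => [|n]; first by rewrite coef_fpsM big_ord1 mul0r.
rewrite coef_fpsM big_ord_recl mul0r add0r big_ord_recl mul1r subSS subn0.
by rewrite big1 ?addr0 // => i _; rewrite mul0r.
Qed.

Lemma coef_fps_sum (I : Type) (r : seq I) (P : pred I) (f : I -> fps) n :
  (\sum_(i <- r | P i) f i) n = \sum_(i <- r | P i) f i n.
Proof. by apply: (big_morph (fun F : fps => F n)); rewrite ?coef_fps0. Qed.

(** A factor 1 + T F cancels: K = - T (F K) expresses each coefficient of K
through the lower ones. *)
Lemma mul_1DT_eq0 F K : (1 + fps_T * F) * K = 0 -> K = 0.
Proof.
move=> FK0; have {FK0} defK : K = - (fps_T * (F * K)).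
  by rewrite -[RHS]add0r -FK0; ring.
apply: fpsP => n; rewrite coef_fps0.
elim/ltn_ind: n => n IHn; rewrite defK; case: n IHn => [|n] IHn.
  by rewrite coef_fpsN coef_TM oppr0.
rewrite coef_fpsN coef_TM coef_fpsM big1 ?oppr0 //.
by move=> i _; rewrite IHn ?mulr0 // ltnS leq_subr.
Qed.

Lemma fps_const_nat m : fps_const (m%:R%:P) = m%:R.
Proof.
elim: m => [|m IHm]; first by [].
rewrite -[in RHS]addn1 -[in LHS]addn1 !natrD -IHm; apply: fpsP => -[|n].
  by rewrite -[RHS]/(_%:P + 1) /fps_const /= polyCD.
by rewrite -[RHS]/(0 + 0 :> {poly rat}) addr0.
Qed.

Lemma fps_constM p q : fps_const (p * q) = fps_const p * fps_const q.
Proof.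
apply: fpsP => n; rewrite coef_constM /fps_const.
by case: ifP; rewrite ?mulr0.
Qed.

Lemma fps_constN p : fps_const (- p) = - fps_const p.
Proof. by apply: fpsP => -[|n]; rewrite coef_fpsN /fps_const /= ?oppr0. Qed.

(** * Derivations and the logarithm *)

Definition fps_derivX (F : fps) : fps := fun n => (F n)^`().

(** The last clause is a quantitative form of T-adic continuity: coefficient n
of [d F] may depend on the coefficients of F up to n + 1, since d_T shifts
degrees by one.  It lets d be computed on an infinite sum such as the logarithm
by computing it on a partial sum. *)
Record derivation (d : fps -> fps) : Prop := Derivation {
  derivationD : forall F G, d (F + G) = d F + d G;
  derivationM : forall F G, d (F * G) = d F * G + F * d G;
  derivationQ : forall c : rat, d (fps_const c%:P) = 0;
  derivation_local : forall F G n,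
    (forall i, (i <= n.+1)%N -> F i = G i) -> d F n = d G n
}.

Lemma derivation_deriv : derivation fps_deriv.
Proof.
split=> [F G|F G|c|F G n eqFG].
- by apply: fpsP => n; apply: mulrnDl.
- apply: fpsP => n.
  have [tF tG] := (@agree_trunc n.+2 F, @agree_trunc n.+2 G).
  have agree_deriv N p (K : fps) : agree N.+1 p K -> agree N p^`() (fps_deriv K).
    by move=> pK i ltiN; rewrite coef_deriv pK.
  have weaken N p (K : fps) : agree N.+1 p K -> agree N p K.
    by move=> pK i ltiN; apply/pK/ltnW.
  rewrite -(agree_deriv _ _ _ (agree_mul tF tG)) // derivM coefD.
  rewrite (agree_mul (agree_deriv _ _ _ tF) (weaken _ _ _ tG)) //.
  by rewrite (agree_mul (weaken _ _ _ tF) (agree_deriv _ _ _ tG)).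
- by apply: fpsP => n; rewrite coef_fps0; apply: mul0rn.
- by rewrite /fps_deriv eqFG.
Qed.

Lemma fps_deriv_const p : fps_deriv (fps_const p) = 0.
Proof. by apply: fpsP => n; rewrite coef_fps0; apply: mul0rn. Qed.

Lemma fps_deriv_T : fps_deriv fps_T = 1.
Proof. by apply: fpsP => -[|n]; rewrite /fps_deriv /fps_T // mul0rn. Qed.

Lemma derivation_derivX : derivation fps_derivX.
Proof.
split=> [F G|F G|c|F G n eqFG].
- by apply: fpsP => n; apply: derivD.
- apply: fpsP => n; rewrite coef_fpsD !coef_fpsM /fps_derivX coef_fpsM.
  rewrite raddf_sum -big_split /=; apply: eq_bigr => i _; exact: derivM.
- apply: fpsP => n; rewrite coef_fps0 /fps_derivX /fps_const.
  by case: ifP; rewrite ?derivC ?deriv0.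
- by rewrite /fps_derivX eqFG.
Qed.

Lemma derivationXn d F m : derivation d ->
  d (F ^+ m.+1) = m.+1%:R * F ^+ m * d F.
Proof.
move=> dd; elim: m => [|m IHm]; first by rewrite expr1 expr0; ring.
by rewrite exprS (derivationM dd) IHm -[m.+2]addn1 natrD !exprS; ring.
Qed.

Definition log1p_sum (N : nat) G : fps :=
  \sum_(1 <= m < N.+1) fps_const ((-1) ^+ m.-1 / m%:R)%:P * G ^+ m.

Lemma fps_log1pE N G n : G 0%N = 0 -> (n <= N)%N ->
  fps_log1p G n = log1p_sum N G n.
Proof.
move=> G0 lenN; rewrite /log1p_sum coef_fps_sum /fps_log1p.
rewrite [RHS](big_cat_nat (n := n.+1)) //= [X in _ = _ + X]big_nat_cond.
rewrite [X in _ = _ + X]big1 ?addr0 => [|m /andP[/andP[ltnm _] _]].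
  by apply: eq_bigr => m _; rewrite coef_constM mul_polyC fps_expE.
by rewrite coef_constM -fps_expE fps_exp_small ?mulr0.
Qed.

(** The terms of the derivative form a geometric series of ratio - G, and
multiplying by 1 + G makes it telescope. *)
Lemma derivation_log1p_sum d G N : derivation d ->
  (1 + G) * d (log1p_sum N G) = d G - (- G) ^+ N * d G.
Proof.
move=> dd; elim: N => [|N IHN].
  rewrite /log1p_sum big_nil expr0 mul1r subrr.
  by rewrite -[0]/(fps_const 0%:P) (derivationQ dd) mulr0.
rewrite /log1p_sum big_nat_recr //= -/(log1p_sum N G) (derivationD dd) mulrDr.
rewrite {}IHN (derivationM dd) (derivationQ dd) mul0r add0r derivationXn //.
have constN1 : fps_const ((-1) ^+ N)%:P = (-1) ^+ N.
  elim: N => // N IHN; rewrite !exprS polyCM fps_constM IHN; congr (_ * _).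
  by rewrite polyCN; apply: fps_constN.
have -> : fps_const ((-1) ^+ N / N.+1%:R)%:P * (N.+1%:R * G ^+ N * d G)
          = (- G) ^+ N * d G.
  rewrite !mulrA -fps_const_nat -fps_constM -polyCM divfK ?pnatr_eq0 //.
  by rewrite constN1 -exprNn.
by rewrite exprS; ring.
Qed.

(** Modulo T^{n+1} the logarithm may be replaced by a partial sum long enough
for the error term, a multiple of G^{n+1} with G = T F, to vanish. *)
Lemma derivation_log1p d F : derivation d ->
  (1 + fps_T * F) * d (fps_log1p (fps_T * F)%R) = d (fps_T * F).
Proof.
move=> dd; set G := fps_T * F; apply: fpsP => n.
have G0 : G 0%N = 0 by rewrite /G coef_TM.
(* Locality of d costs one degree, hence n + 1 terms. *)
transitivity (((1 + G) * d (log1p_sum n.+1 G)) n).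
  apply: eq_bigr => i _; congr (_ * _); apply: (derivation_local dd) => j lej.
  apply: fps_log1pE => //; apply: leq_trans lej _.
  by rewrite ltnS leq_subr.
rewrite (derivation_log1p_sum _ _ dd).
rewrite coef_fpsD coef_fpsN coef_fpsM big1 ?subr0 // => i _.
by rewrite -fps_expE fps_exp_small ?mul0r // coef_fpsN G0 oppr0.
Qed.

(** * The derivation attached to Lambert families *)

Definition lambert_deriv F : fps :=
  (1 + fps_T) * fps_derivX F - fps_T * (fps_T * fps_deriv F).

Lemma derivation_lambert : derivation lambert_deriv.
Proof.
have [[XD XM XQ Xl] [TD TM TQ Tl]] := (derivation_derivX, derivation_deriv).
split=> [F G|F G|c|F G n eqFG]; rewrite /lambert_deriv.
- by rewrite XD TD; ring.
- by rewrite XM TM; ring.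
- by rewrite XQ TQ; ring.
have eqX i : (i <= n)%N -> fps_derivX F i = fps_derivX G i.
  by move=> lein; apply: Xl => j /leq_trans lej; apply: eqFG (lej _ _).
have eqT i : (i <= n)%N -> fps_deriv F i = fps_deriv G i.
  by move=> lein; apply: Tl => j /leq_trans lej; apply: eqFG (lej _ _).
congr (_ - _); first by apply: eq_bigr => i _; rewrite eqX ?leq_subr.
rewrite !coef_TM; case: n eqT {eqFG eqX} => // n eqT; rewrite !coef_TM.
by case: n eqT => // n eqT; rewrite eqT // ltnW.
Qed.

Lemma lambert_deriv0 F : lambert_deriv F 0%N = (F 0%N)^`().
Proof.
rewrite /lambert_deriv mulrDl mul1r !coef_fpsD coef_fpsN !coef_TM.
by rewrite addr0 subr0.
Qed.

Lemma lambert_derivS F n :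
  lambert_deriv F n.+1 = (F n.+1)^`() + (F n)^`() - F n *+ n.
Proof.
rewrite /lambert_deriv mulrDl mul1r !coef_fpsD coef_fpsN !coef_TM.
by case: n => [|n].
Qed.

Lemma deriv_eq0_at0 (p : {poly rat}) : p^`() = 0 -> p.[0] = 0 -> p = 0.
Proof.
move=> dp0 p0; apply/polyP => -[|i]; rewrite coef0 -?horner_coef0 //.
move/(congr1 (fun q : {poly rat} => q`_i)): dp0.
by rewrite coef_deriv coef0 => /eqP; rewrite mulrn_eq0 => /eqP.
Qed.

(** Inductively F_n = 0 reduces the coefficient n + 1 of [lambert_deriv F] to
F_{n+1}', so F_{n+1} is a constant, and its value at 0 is 0. *)
Lemma lambert_deriv_inj F :
  lambert_deriv F = 0 -> (forall n, (F n).[0] = 0) -> F = 0.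
Proof.
move=> DF0 F0; apply: fpsP => n; rewrite coef_fps0.
elim: n => [|n IHn]; apply: deriv_eq0_at0 => //.
  by rewrite -lambert_deriv0 DF0.
have := lambert_derivS F n; rewrite DF0 coef_fps0 IHn deriv0 mul0rn.
by rewrite addr0 subr0.
Qed.

Lemma log1p_at0 G n : (forall i, (G i).[0] = 0) -> (fps_log1p G n).[0] = 0.
Proof.
move=> G0; rewrite /fps_log1p big_nat_cond horner_sum big1 // => m.
case: m => [|m] // _; rewrite hornerZ fps_expE exprS coef_fpsM.
rewrite horner_sum big1 ?mulr0 //.
by move=> i _; rewrite hornerM G0 mul0r.
Qed.

(** * Lambert families *)

Lemma primitiveD p q : primitive (p + q) = primitive p + primitive q.
Proof.
apply/polyP => i; rewrite coefD !coef_primitive.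
by case: i => [|i]; rewrite ?addr0 // coefD mulrDl.
Qed.

Lemma primitiveZ c p : primitive (c *: p) = c *: primitive p.
Proof.
apply/polyP => i; rewrite coefZ !coef_primitive.
by case: i => [|i]; rewrite ?mulr0 // coefZ mulrA.
Qed.

Lemma lambert_at0 A P n (hP : lambert_family A P) : (P n).[0] = 0.
Proof.
have [A0 P0 PS] := hP; elim: n => [|n IHn]; first by rewrite P0.
by rewrite PS hornerD hornerN hornerZ primitive_at0 IHn oppr0 mulr0 addr0.
Qed.

Lemma lambert_deriv_family A P (hP : lambert_family A P) :
  lambert_deriv P = fps_const A^`().
Proof.
have [_ P0 PS] := hP; apply: fpsP => -[|n]; first by rewrite lambert_deriv0 P0.
rewrite lambert_derivS PS derivD derivN derivZ deriv_primitive.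
by rewrite scaler_nat addrAC addrK addNr.
Qed.

Lemma lambert_implicit F (hL : lambert_family (- 'X) F) :
  fps_log1p (fps_T * F)%R + F = fps_const (- 'X).
Proof.
have dD := derivation_lambert.
have DT : lambert_deriv fps_T = - (fps_T * fps_T).
  rewrite /lambert_deriv.
  have -> : fps_derivX fps_T = 0.
    apply: fpsP => n; rewrite coef_fps0 /fps_derivX /fps_T.
    by case: ifP; rewrite ?derivC ?deriv0.
  by rewrite fps_deriv_T; ring.
have DF : lambert_deriv F = - 1.
  rewrite (lambert_deriv_family hL) derivN derivX; exact: fps_constN.
have DX : lambert_deriv (fps_const 'X) = 1 + fps_T.
  rewrite /lambert_deriv.
  have -> : fps_derivX (fps_const 'X) = 1.
    by apply: fpsP => -[|n]; rewrite /fps_derivX /= ?derivX ?deriv0.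
  by rewrite fps_deriv_const; ring.
have DG : lambert_deriv (fps_T * F) = - fps_T * (1 + fps_T * F).
  by rewrite (derivationM dD) DT DF; ring.
have Dlog : lambert_deriv (fps_log1p (fps_T * F)%R) = - fps_T.
  apply/eqP; rewrite -subr_eq0; apply/eqP; apply: (@mul_1DT_eq0 F).
  by rewrite mulrBr derivation_log1p // DG; ring.
apply/eqP; rewrite fps_constN -subr_eq0 opprK; apply/eqP.
apply: lambert_deriv_inj.
  by rewrite 2!(derivationD dD) Dlog DF DX; ring.
move=> n; rewrite !coef_fpsD !hornerD (lambert_at0 _ hL) log1p_at0 => [|i].
  by rewrite /fps_const; case: ifP; rewrite ?hornerX ?horner0 !addr0.
rewrite coef_TM; case: i => [|i]; first exact: horner0.
exact: lambert_at0 hL.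
Qed.

(** The derivative in T of the implicit equation, cleared of its denominator
1 + T F. *)
Lemma lambert_ode F (hL : lambert_family (- 'X) F) :
  fps_T * F * fps_deriv F + (1 + fps_T) * fps_deriv F + F = 0.
Proof.
have dT := derivation_deriv.
have /(congr1 fps_deriv) := lambert_implicit hL.
rewrite (derivationD dT) => eq_d.
have := derivation_log1p F dT.
rewrite (derivationM dT) fps_deriv_T mul1r => dlog.
move/(congr1 ( *%R (1 + fps_T * F))): eq_d.
rewrite mulrDr dlog fps_deriv_const mulr0 => <-; ring.
Qed.

(** Twice the differential equation reads
T d_T (F^2) + 2 (d_T F + T d_T F + F) = 0; this is its coefficient of T^n. *)
Lemma lambert_sqr_coef F n (hL : lambert_family (- 'X) F) :
  (F ^+ 2) n *+ n + (F n.+1 + F n) *+ (2 * n.+1) = 0.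
Proof.
case: n => [|n].
  by have [_ L0 ->] := hL; rewrite scale0r addr0 addNr mul0rn addr0.
have dT := derivation_deriv.
have ode2 : fps_T * fps_deriv (F ^+ 2)%R
   + 2%:R * (fps_deriv F + fps_T * fps_deriv F + F) = 0.
  rewrite derivationXn // -[RHS](mulr0 2%:R) -[in RHS](lambert_ode hL); ring.
move/(congr1 (fun K : fps => K n.+1)): ode2.
rewrite coef_fps0 mulr_natl mulr2n.
set S := _ + F; have SE : S n.+1 = (F n.+2 + F n.+1) *+ n.+2.
  by rewrite /S !coef_fpsD coef_TM /fps_deriv -addrA -mulrSr mulrnDl.
rewrite !coef_fpsD SE coef_TM => <-; congr (_ + _).
by rewrite -mulr2n -mulrnA mulnC.
Qed.

(** For n > 0 the recursion replaces F_{n+1} + F_n by n times the primitive of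
F_n, and the factor n cancels.  For n = 0 the coefficient identity is void and
both sides are computed to be X^2. *)
Lemma lambert_sqr F n (hL : lambert_family (- 'X) F) :
  (F ^+ 2) n = - (2 * n.+1%:R) *: primitive (F n).
Proof.
case: n => [|n].
  have [_ L0 _] := hL; rewrite expr2 coef_fpsM big_ord1 L0.
  have -> : primitive (- 'X) = - (2^-1 *: 'X^2).
    apply/polyP => i; rewrite coef_primitive coefN coefZ coefXn.
    by case: i => [|[|[|i]]];
      rewrite ?coefN ?coefX /= ?oppr0 ?mul0r ?mulr0 ?oppr0 // mulr1 mulN1r.
  by rewrite mulrNN -expr2 scalerN scaleNr opprK scalerA divff // scale1r.
have := lambert_sqr_coef n.+1 hL; have [_ _ ->] := hL.
rewrite addrAC addNr add0r scaler_nat -mulrnA [(n.+1 * _)%N]mulnC mulrnA.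
rewrite -mulrnDl => /eqP.
rewrite -scaler_nat scaler_eq0 pnatr_eq0 /= addr_eq0 => /eqP->.
by rewrite scaleNr -natrM scaler_nat.
Qed.

Theorem theorem4p4 (L : nat -> {poly rat}) (hL : lambert_family (- 'X) L) :
  let F : fps := L in
  let F' : fps := fps_deriv F in
  let L2 : nat -> {poly rat} := (F ^+ 2)%fps in
  [/\ (forall n : nat, (1 <= n)%N ->
         L2 n = - (2 * n.+1%:R) *: primitive (L n)
         /\ L2 n = - ((2 * n.+1%:R) / n%:R) *: (L n.+1 + L n))
      /\ lambert_family ('X ^+ 2) (fun n => n.+1%:R^-1 *: L2 n),
      (fps_T * F * F' + (1 + fps_T) * F' + F)%fps =1 0%fps
    & (fps_log1p (fps_T * F) + F)%fps =1 fps_const (- 'X)].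
Proof.
move=> F F' L2.
have sqrE n : L2 n = - (2 * n.+1%:R) *: primitive (L n).
  by rewrite /L2 fps_expE; apply: lambert_sqr.
have [_ L0 LS] := hL.
split; last 2 first.
- by move=> n; rewrite -[RHS]/((0 : fps) n) -(lambert_ode hL).
- by move=> n; rewrite -(lambert_implicit hL).
split=> [n n_gt0|].
  split=> //; rewrite sqrE LS addrAC addNr add0r scalerA.
  by rewrite mulNr divfK // pnatr_eq0 -lt0n.
have normE n : n.+1%:R^-1 *: L2 n = (- 2) *: primitive (L n).
  by rewrite sqrE scalerA mulrN mulrCA mulVf ?mulr1 // pnatr_eq0.
split=> [||n].
- by rewrite hornerXn expr0n.
- by rewrite invr1 scale1r /L2 fps_expE expr2 coef_fpsM big_ord1 /F L0 mulrNN.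
rewrite !normE LS -[- L n]scaleN1r primitiveD !primitiveZ scalerDr !scalerA.
by rewrite -scaleNr mulrN1 [n%:R * _]mulrC.
Qed.
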